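(* There exist a field $k$, a polynomial ring $R=k[X_1,\ldots,X_n]$ over $k$, and an ideal $J\subset R$ generated by three cubic forms (homogeneous polynomials of degree $3$) such that $\operatorname{pd}(R/J)=5$.
   Context: $\operatorname{pd}(R/J)$ denotes the projective dimension of $R/J$ as an $R$-module. *)

(* Defs.v *)
From HB Require Import structures.
From mathcomp Require Import all_boot all_algebra.
From mathcomp Require Import boolp.
From mathcomp Require Import mpoly.

Set Implicit Arguments.
Unset Strict Implicit.
Unset Printing Implicit Defensive.

Import GRing.Theory.
Import Quotient.

Local Open Scope ring_scope.
Local Open Scope quotient_scope.

(* The quotient module V / N: the additive quotient {quot _}, with the scalar
   action induced from V. *)
Section QuotientModule.
Variables (R : pzRingType) (V : lmodType R) (N : submodClosed V).

(* [submodClosed] does not inherit from the [zmodClosed] required by [{quot _}],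
   since it is also meant for semimodules. *)
Definition submod_pred : {pred V} := fun v => v \in N.

Fact submod_pred_zmod_closed : zmod_closed submod_pred.
Proof. exact: (GRing.submod_closedB (submodClosedP N)). Qed.

HB.instance Definition _ :=
  GRing.isZmodClosed.Build V submod_pred submod_pred_zmod_closed.

Definition quotmod : Type := {quot submod_pred}.

HB.instance Definition _ := GRing.Zmodule.on quotmod.

Definition quotmod_scale (a : R) (x : quotmod) : quotmod :=
  \pi_({quot submod_pred}) (a *: repr x).

Lemma quotmod_scale_pi (a : R) (v : V) :
  quotmod_scale a (\pi_({quot submod_pred}) v) = \pi_({quot submod_pred}) (a *: v).
Proof.
apply/eqP; rewrite -idealrBE -scalerBr; apply: (@rpredZ _ _ N).
by rewrite -[_ \in N]/(_ \in submod_pred) idealrBE reprK.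
Qed.

Fact quotmod_scaleA (a b : R) (x : quotmod) :
  quotmod_scale a (quotmod_scale b x) = quotmod_scale (a * b) x.
Proof. by rewrite {2}/quotmod_scale quotmod_scale_pi scalerA. Qed.

Fact quotmod_scale1 : left_id 1 quotmod_scale.
Proof. by move=> x; rewrite /quotmod_scale scale1r reprK. Qed.

Fact quotmod_scaleDr : right_distributive quotmod_scale +%R.
Proof.
move=> a x y; rewrite -[x]reprK -[y]reprK -[_ + _]raddfD /=.
by rewrite !quotmod_scale_pi scalerDr raddfD.
Qed.

Fact quotmod_scaleDl (x : quotmod) :
  {morph quotmod_scale^~ x : a b / a + b}.
Proof. by move=> a b; rewrite /quotmod_scale scalerDl raddfD. Qed.

HB.instance Definition _ := GRing.Zmodule_isLmodule.Build R quotmod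
  quotmod_scaleA quotmod_scale1 quotmod_scaleDr quotmod_scaleDl.

End QuotientModule.

Section IdealGen.
Variables (R : comNzRingType) (m : nat) (f : 'I_m -> R).

(* Stated over the regular module R^o, so that quotmod (ideal_gen f) is R / (f)
   as an R-module. *)
Definition ideal_gen : {pred R^o} :=
  fun x => `[< exists a : 'I_m -> R, x = \sum_i a i * f i >].

Fact ideal_gen_submod_closed : submod_closed ideal_gen.
Proof.
split=> [|c x y /asboolP[a ->] /asboolP[b ->]]; apply/asboolP.
  by exists (fun=> 0); rewrite big1 // => i _; rewrite mul0r.
exists (fun i => c * a i + b i); rewrite scaler_sumr -big_split /=.
by apply: eq_bigr => i _; rewrite mulrDl -mulrA.
Qed.

HB.instance Definition _ :=
  GRing.isSubmodClosed.Build R R^o ideal_gen ideal_gen_submod_closed.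

End IdealGen.

Section ProjectiveDimension.
Variable R : pzRingType.

Definition surj (A B : Type) (g : A -> B) : Prop := forall y, exists x, g x = y.

Definition exact_at (A B C : lmodType R) (g : A -> B) (h : B -> C) : Prop :=
  forall y : B, h y = 0 <-> exists x : A, g x = y.

Definition projective (P : lmodType R) : Prop :=
  forall (A B : lmodType R) (g : {linear A -> B}) (h : {linear P -> B}),
    surj g -> exists h' : {linear P -> A}, forall x, g (h' x) = h x.

(* ... -> P_2 -> P_1 -> P_0 -> M -> 0 with P_i = res_obj i. *)
Record proj_resolution (M : lmodType R) := ProjResolution {
  res_obj : nat -> lmodType R;
  res_diff : forall i, {linear res_obj i.+1 -> res_obj i};
  res_aug : {linear res_obj 0 -> M};
  res_proj : forall i, projective (res_obj i);
  res_aug_surj : surj res_aug;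
  res_exact0 : exact_at (res_diff 0) res_aug;
  res_exactS : forall i, exact_at (res_diff i.+1) (res_diff i)
}.

Definition res_length_le (M : lmodType R) (C : proj_resolution M) (d : nat) :=
  forall i, (d < i)%N -> forall x : res_obj C i, x = 0.

Definition pd_le (M : lmodType R) (d : nat) : Prop :=
  exists C : proj_resolution M, res_length_le C d.

(* The zero module gets projective dimension 0, not -oo; a module without a
   finite projective resolution satisfies pd_eq M d for no d. *)
Definition pd_eq (M : lmodType R) (d : nat) : Prop :=
  pd_le M d /\ forall e, pd_le M e -> (d <= e)%N.

End ProjectiveDimension.

(* Main.v *)
Require Import Defs.
From HB Require Import structures.
From mathcomp Require Import all_boot all_algebra mpoly.
From mathcomp Require Import boolp ring.

(* Take k = rat, R = k[x, y, a, b, c] and J = (x^3, y^3, f) with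
   f = a x^2 + b x y + c y^2.  The class of x^2 y^2 spans a copy of k in R/J, so
   R/J has depth 0.  The quotient (x^3, y^3) : f is generated by x^3, x^2 y,
   x y^2, y^3 and the three g_i = p x^2 + q x y + r y^2 coming from the Koszul
   syzygies (p, q, r) of (c, b, a).  Resolving these g_i over the Koszul complex
   of (x, y) and taking mapping cones yields a minimal free resolution of R/J
   with ranks 1, 3, 8, 10, 5, 1.  Its exactness reduces to the regularity of the
   variables, by comparing coefficients of binary forms in x, y modulo (x, y).
   Against a projective resolution of length at most 4, the comparison theorem
   would split the last differential R -> R^5, which is impossible since the
   entries of that differential vanish at the origin. *)

Set Implicit Arguments.
Unset Strict Implicit.
Unset Printing Implicit Defensive.

Import GRing.Theory.
Import Quotient.

Local Open Scope ring_scope.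

(** * Comparison of projective resolutions *)

(** Serves to build chain maps and homotopies degree by degree: [P] is the invariant that makes the
    next choice possible, [Q] the relation between consecutive choices. *)
Lemma dependent_choice (T : nat -> Type) (A : T 0 -> Prop)
    (P : forall i, T i -> Prop) (Q : forall i, T i -> T i.+1 -> Prop) :
    (exists2 t, A t & P 0 t) ->
    (forall i t, P i t -> exists2 t', Q i t t' & P i.+1 t') ->
  exists2 f : forall i, T i, A (f 0) & forall i, Q i (f i) (f i.+1).
Proof.
move=> base step; case/cid2: base => t0 At0 Pt0.
pose nxt i (t : {t : T i | P i t}) : {t' : T i.+1 | P i.+1 t'} :=
  let: exist2 t' _ Pt' := cid2 (step i (sval t) (svalP t)) in exist _ t' Pt'.
have nxtP i t : Q i (sval t) (sval (nxt i t)) by rewrite /nxt; case: cid2.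
pose g := fix g i : {t : T i | P i t} :=
  if i is i'.+1 then nxt i' (g i') else exist _ t0 Pt0.
by exists (fun i => sval (g i)) => [|i]; last exact: nxtP.
Qed.

Section RangeModule.
Variables (R : pzRingType) (A B : lmodType R) (g : {linear A -> B}).

Definition range_pred : {pred B} := fun y => `[< exists x, g x = y >].

Fact range_submod_closed : submod_closed range_pred.
Proof.
split=> [|c _ _ /asboolP[x <-] /asboolP[y <-]]; apply/asboolP.
  by exists 0; rewrite linear0.
by exists (c *: x + y); rewrite linearP.
Qed.

HB.instance Definition _ :=
  GRing.isSubmodClosed.Build R B range_pred range_submod_closed.

Definition range_mod := {y | y \in range_pred}.
HB.instance Definition _ := SubChoice.on range_mod.
HB.instance Definition _ := [SubChoice_isSubLmodule of range_mod by <:].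

End RangeModule.

Section Projective.
Variable R : pzRingType.

(** Both maps are corestricted to the image of [g], where [g] becomes surjective. *)
Lemma projective_lift (P A B : lmodType R) (g : {linear A -> B})
    (f : {linear P -> B}) :
    projective P -> (forall x, exists y, g y = f x) ->
  exists h : {linear P -> A}, forall x, g (h x) = f x.
Proof.
move=> projP fg.
have gP x : g x \in range_pred g by apply/asboolP; exists x.
have fP x : f x \in range_pred g by apply/asboolP; exact: fg.
pose g' x : range_mod g := exist _ (g x) (gP x).
pose f' x : range_mod g := exist _ (f x) (fP x).
have g'lin : linear g' by move=> c u v; apply: val_inj; rewrite /= linearP.
have f'lin : linear f' by move=> c u v; apply: val_inj; rewrite /= linearP.
pose G := GRing.isLinear.Build _ _ _ _ g' g'lin.
pose F := GRing.isLinear.Build _ _ _ _ f' f'lin.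
pose gl : {linear A -> range_mod g} := HB.pack g' G.
pose fl : {linear P -> range_mod g} := HB.pack f' F.
have [|h hP] := projP _ _ gl fl.
  by case=> y yP; case/asboolP: (yP) => x gx; exists x; exact: val_inj.
by exists h => x; have /(congr1 val) := hP x.
Qed.

Lemma projective_regular : projective (R^o : lmodType R).
Proof.
move=> A B g f gsurj; have [a ga] := gsurj (f 1).
pose h (x : R^o) := x *: a.
have hlin : linear h by move=> c u v; rewrite /h scalerDl scalerA.
pose H := GRing.isLinear.Build _ _ _ _ h hlin.
exists (HB.pack h H : {linear R^o -> A}) => x /=.
by rewrite /h linearZ ga -linearZ /= /GRing.scale /= mulr1.
Qed.

Lemma projective_prod (P Q : lmodType R) :
  projective P -> projective Q -> projective (P * Q)%type.
Proof.
move=> projP projQ A B g f gsurj.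
have inlP : linear (fun p : P => f (p, 0)).
  by move=> c u v; rewrite -linearP; congr (f (_, _)); rewrite /= scaler0 addr0.
have inrP : linear (fun q : Q => f (0, q)).
  by move=> c u v; rewrite -linearP; congr (f (_, _)); rewrite /= scaler0 addr0.
pose IL := GRing.isLinear.Build _ _ _ _ _ inlP.
pose IR := GRing.isLinear.Build _ _ _ _ _ inrP.
have [hp hpP] := projP _ _ g (HB.pack (fun p : P => f (p, 0)) IL) gsurj.
have [hq hqP] := projQ _ _ g (HB.pack (fun q : Q => f (0, q)) IR) gsurj.
pose h (x : P * Q) := hp x.1 + hq x.2.
have hlin : linear h.
  by move=> c u v; rewrite /h /= !linearP scalerDr addrACA.
pose H := GRing.isLinear.Build _ _ _ _ _ hlin.
exists (HB.pack h H : {linear (P * Q)%type -> A}) => -[p q] /=.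
rewrite /h linearD /= hpP hqP /= -linearD.
by congr (f (_, _)); rewrite /= ?addr0 ?add0r.
Qed.

Lemma projective_zero (P : lmodType R) : (forall x : P, x = 0) -> projective P.
Proof.
move=> P0 A B g f _.
by exists (\0 : {linear P -> A}) => x; rewrite (P0 x) !linear0.
Qed.

End Projective.

Section Comparison.
Variables (R : pzRingType) (M : lmodType R).
Implicit Types F C : proj_resolution M.

Lemma res_diff_diff F i x : res_diff F i (res_diff F i.+1 x) = 0.
Proof. by apply/res_exactS; exists x. Qed.

Lemma res_aug_diff F x : res_aug F (res_diff F 0 x) = 0.
Proof. by apply/res_exact0; exists x. Qed.

Lemma comparison F C :
  exists2 f : forall i, {linear res_obj F i -> res_obj C i},
    (forall x, res_aug C (f 0 x) = res_aug F x)
    & forall i x, res_diff C i (f i.+1 x) = f i (res_diff F i x).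
Proof.
apply: (@dependent_choice (fun i => {linear res_obj F i -> res_obj C i})
   (fun t => forall x, res_aug C (t x) = res_aug F x)
   (fun i t => forall x, exists y, res_diff C i y = t (res_diff F i x))
   (fun i t t' => forall x, res_diff C i (t' x) = t (res_diff F i x))).
  have [x|f fP] := projective_lift (f := res_aug F) (g := res_aug C) (@res_proj _ _ F 0).
    exact: res_aug_surj.
  exists f => // x; apply/res_exact0.
  by rewrite fP res_aug_diff.
move=> i t tP.
have [x|f fP] := projective_lift (f := t \o res_diff F i) (g := res_diff C i)
  (@res_proj _ _ F i.+1).
  exact: tP.
exists f => // x; apply/res_exactS.
by rewrite fP /= res_diff_diff linear0.
Qed.

(** At each stage [f i.+1] minus the part already accounted for takes values in cycles of [C], hence
    in boundaries, and projectivity lifts it. *)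
Lemma null_homotopy F C (f : forall i, {linear res_obj F i -> res_obj C i}) :
    (forall x, res_aug C (f 0 x) = 0) ->
    (forall i x, res_diff C i (f i.+1 x) = f i (res_diff F i x)) ->
  exists h : forall i, {linear res_obj F i -> res_obj C i.+1},
    forall i x, f i.+1 x = res_diff C i.+1 (h i.+1 x) + h i (res_diff F i x).
Proof.
move=> f0 fS.
have [||h _ hP] := @dependent_choice
   (fun i => {linear res_obj F i -> res_obj C i.+1}) (fun=> True)
   (fun i t => forall x, exists y,
       res_diff C i.+1 y = f i.+1 x - t (res_diff F i x))
   (fun i t t' => forall x,
       res_diff C i.+1 (t' x) = f i.+1 x - t (res_diff F i x)).
- have [x|t tP] := projective_lift (f := f 0) (g := res_diff C 0) (@res_proj _ _ F 0).
    by apply/res_exact0.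
  exists t => // x; apply/res_exactS.
  by rewrite linearB /= fS tP subrr.
- move=> i t tP.
  have [x|t' t'P] := projective_lift (f := f i.+1 \- (t \o res_diff F i))
    (g := res_diff C i.+1) (@res_proj _ _ F i.+1).
    exact: tP.
  exists t' => // x; apply/res_exactS.
  by rewrite linearB /= fS t'P /= res_diff_diff linear0 subr0 subrr.
by exists h => i x; rewrite hP subrK.
Qed.

(* Compare F with a resolution vanishing in degree i.+1 and compose back: the
   resulting endomorphism of F is homotopic to the identity and zero in degree
   i.+1. *)
Lemma pd_le_split F i :
    pd_le M i -> (forall x : res_obj F i.+2, x = 0) ->
  exists h : {linear res_obj F i -> res_obj F i.+1},
    forall x, h (res_diff F i x) = x.
Proof.
move=> [C Cle] F0; have [f f0 fS] := comparison F C.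
have [g g0 gS] := comparison C F.
have [||h hP] := @null_homotopy F F (fun i => idfun \- (g i \o f i)).
- by move=> x; rewrite /= linearB /= g0 f0 subrr.
- by move=> j x; rewrite /= linearB /= gS fS.
exists (h i) => x; have := hP i x.
by rewrite /= (Cle i.+1 (ltnSn i) (f _ x)) linear0 subr0 (F0 (h _ x)) linear0 add0r.
Qed.

Lemma pd_le_leq d e : (d <= e)%N -> pd_le M d -> pd_le M e.
Proof. by move=> le_de [C Cle]; exists C => i /(leq_ltn_trans le_de)/Cle. Qed.

End Comparison.

(** * The differentials *)

Lemma pair_ext (A B : Type) (p q : A * B) : p.1 = q.1 -> p.2 = q.2 -> p = q.
Proof. by case: p q => ? ? [? ?] /= -> ->. Qed.

Ltac triple_ext := apply: pair_ext; [apply: pair_ext|].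

Section Differentials.
Variables (R : comNzRingType) (x y a b c : R).

Definition F1 : lmodType R := (R^o * R^o * R^o)%type.
Definition F2 : lmodType R := (R^o * (R^o * R^o * R^o * R^o) * F1)%type.
Definition F3 : lmodType R := (F1 * F1 * F1 * R^o)%type.
Definition F4 : lmodType R := (F1 * (R^o * R^o))%type.

Definition cubic_form : R := x ^+ 2 * a + x * y * b + y ^+ 2 * c.

(* The differentials of the iterated mapping cone.  Below, e is the coordinate
   on the Koszul relation of x^3 and y^3; the m_i and g_i are coordinates on the
   generators of (x^3, y^3) : f; the s_i on the syzygies of x^3, x^2 y, x y^2,
   y^3; X_i, Y_i and t on the relations expressing x g_i and y g_i through the
   m_j and on a g_1 - b g_2 + c g_3 = 0. *)
Definition d1 (z : F1) : R^o :=
  let: (u, v, w) := z in u * x ^+ 3 + v * y ^+ 3 + w * cubic_form.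

Definition d2 (z : F2) : F1 :=
  let: (e, (m0, m1, m2, m3), (g1, g2, g3)) := z in
  (- (y ^+ 3 * e) + cubic_form * m0 + (a * x * y + b * y ^+ 2) * m1
     + a * y ^+ 2 * m2 + (a * b * x + (b ^+ 2 - a * c) * y) * g1
     + (a ^+ 2 * x + a * b * y) * g2 + a ^+ 2 * y * g3,
   x ^+ 3 * e + c * x ^+ 2 * m1 + (b * x ^+ 2 + c * x * y) * m2
     + cubic_form * m3 - c ^+ 2 * x * g1 - (b * c * x + c ^+ 2 * y) * g2
     + ((a * c - b ^+ 2) * x - b * c * y) * g3,
   - (x ^+ 3 * m0 + x ^+ 2 * y * m1 + x * y ^+ 2 * m2 + y ^+ 3 * m3
     + (b * x ^+ 2 - c * x * y) * g1 + (a * x ^+ 2 - c * y ^+ 2) * g2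
     + (a * x * y - b * y ^+ 2) * g3)).

Definition d3 (z : F3) : F2 :=
  let: ((s0, s1, s2), (X1, X2, X3), (Y1, Y2, Y3), t) := z in
  (- (c * s0 + b * s1 + a * s2),
   (- (y * s0) - b * X1 - a * X2,
    x * s0 - y * s1 + c * X1 - b * Y1 - a * Y2 - a * X3,
    x * s1 - y * s2 + c * Y1 + c * X2 + b * X3 - a * Y3,
    x * s2 + c * Y2 + b * Y3),
   (x * X1 + y * Y1 + a * t, x * X2 + y * Y2 - b * t, x * X3 + y * Y3 + c * t)).

Definition d4 (z : F4) : F3 :=
  let: ((p1, p2, p3), (u, v)) := z in
  ((b * p1 + a * p2, - (c * p1) + a * p3, - (c * p2) - b * p3),
   (- (y * p1) - a * u, - (y * p2) + b * u, - (y * p3) - c * u),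
   (x * p1 - a * v, x * p2 + b * v, x * p3 - c * v),
   x * u + y * v).

Definition d5 (r : R^o) : F4 :=
  ((a * r, - (b * r), c * r), (- (y * r), x * r)).

Fact d1_linear : linear d1.
Proof.
move=> k [[u v] w] [[u' v'] w']; rewrite /= /GRing.scale /=.
ring.
Qed.

Fact d2_linear : linear d2.
Proof.
move=> k [[e [[[m0 m1] m2] m3]] [[g1 g2] g3]].
move=> [[e' [[[m0' m1'] m2'] m3']] [[g1' g2'] g3']].
triple_ext; rewrite /=; do ?rewrite /GRing.scale /=; ring.
Qed.

Fact d3_linear : linear d3.
Proof.
move=> k [[[[[s0 s1] s2] [[X1 X2] X3]] [[Y1 Y2] Y3]] t].
move=> [[[[[s0' s1'] s2'] [[X1' X2'] X3']] [[Y1' Y2'] Y3']] t'].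
apply: pair_ext; [apply: pair_ext; [|apply: pair_ext; [triple_ext|]]|triple_ext];
  rewrite /=; do ?rewrite /GRing.scale /=; ring.
Qed.

Fact d4_linear : linear d4.
Proof.
move=> k [[[p1 p2] p3] [u v]] [[[p1' p2'] p3'] [u' v']].
apply: pair_ext; [triple_ext; triple_ext|];
  rewrite /=; do ?rewrite /GRing.scale /=; ring.
Qed.

Fact d5_linear : linear d5.
Proof.
move=> k r r'; apply: pair_ext; [triple_ext|apply: pair_ext];
  rewrite /=; do ?rewrite /GRing.scale /=; ring.
Qed.

HB.instance Definition _ := GRing.isLinear.Build R F1 R^o _ d1 d1_linear.
HB.instance Definition _ := GRing.isLinear.Build R F2 F1 _ d2 d2_linear.
HB.instance Definition _ := GRing.isLinear.Build R F3 F2 _ d3 d3_linear.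
HB.instance Definition _ := GRing.isLinear.Build R F4 F3 _ d4 d4_linear.
HB.instance Definition _ := GRing.isLinear.Build R R^o F4 _ d5 d5_linear.

Lemma d1_d2 z : d1 (d2 z) = 0.
Proof.
case: z => [[e [[[m0 m1] m2] m3]] [[g1 g2] g3]].
rewrite /d1 /d2 /cubic_form; ring.
Qed.

Lemma d2_d3 z : d2 (d3 z) = 0.
Proof.
case: z => [[[[[s0 s1] s2] [[X1 X2] X3]] [[Y1 Y2] Y3]] t].
triple_ext; rewrite /= /cubic_form; ring.
Qed.

Lemma d3_d4 z : d3 (d4 z) = 0.
Proof.
case: z => [[[p1 p2] p3] [u v]].
apply: pair_ext; [apply: pair_ext; [|apply: pair_ext; [triple_ext|]]|triple_ext];
  rewrite /=; ring.
Qed.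

Lemma d4_d5 r : d4 (d5 r) = 0.
Proof.
apply: pair_ext; [triple_ext; triple_ext|];
  rewrite /=; ring.
Qed.

End Differentials.

(** * Regular pairs and exactness of the complex *)

(** Turns [p = q] into an identity for [ring], with [k] the coefficient of the known equation
    [u = v]. *)
Lemma eq_lincomb (R : comNzRingType) (k p q u v : R) :
  u = v -> p - q = k * (u - v) -> p = q.
Proof. by move=> ->; rewrite subrr mulr0 => /eqP; rewrite subr_eq0 => /eqP. Qed.

(** All relations between [p] and [q] are Koszul. In a domain with [p != 0] this means that [q] is a
    nonzerodivisor modulo [p]. *)
Definition regular_pair (R : comNzRingType) (p q : R) :=
  forall u v, p * u = q * v -> exists2 r, u = q * r & v = p * r.

Section RegularPair.
Variable R : idomainType.
Implicit Types p q : R.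

Lemma regular_pair_sym p q : regular_pair p q -> regular_pair q p.
Proof. by move=> pq u v /esym/pq[r -> ->]; exists r. Qed.

Lemma regular_pairM p p' q : q != 0 ->
  regular_pair p q -> regular_pair p' q -> regular_pair (p * p') q.
Proof.
move=> q0 pq p'q u v; rewrite -mulrA => /pq[r + ->] => /p'q[w -> ->].
by exists w; rewrite ?mulrA.
Qed.

Lemma regular_pairX p q n : q != 0 ->
  regular_pair p q -> regular_pair (p ^+ n) q.
Proof.
move=> q0 pq; elim: n => [|n IHn]; last by rewrite exprS; exact: regular_pairM.
by move=> u v; rewrite expr0 mul1r => ->; exists v; rewrite ?mul1r.
Qed.

End RegularPair.

(* e is the retraction of R onto k[a, b, c] that sets x = y = 0, so reduction
   modulo (x, y) can be computed inside R. *)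
Section Exactness.
Variables (R : idomainType) (x y a b c : R) (e : {rmorphism R -> R}).
Hypotheses (ex : e x = 0) (ey : e y = 0).
Hypotheses (ea : e a = a) (eb : e b = b) (ec : e c = c).
Hypothesis e_split : forall p, exists u v, p = e p + x * u + y * v.
Hypotheses (x0 : x != 0) (y0 : y != 0) (a0 : a != 0).
(* Up to sign, the determinant of multiplication by the cubic from the degree 1
   part to the degree 3 part of R / (x^3, y^3), graded by degree in x and y. *)
Hypothesis disc0 : b ^+ 2 - a * c != 0.
Hypotheses (xy_reg : regular_pair x y) (ab_reg : regular_pair a b).
Hypothesis abc_reg : forall p q r, a * p + b * q + c * r = 0 ->
  exists u v w, [/\ p = - (c * v) - b * w, q = a * w - c * u & r = b * u + a * v].

Let Xn_reg n : regular_pair (x ^+ n) y.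
Proof. exact: regular_pairX. Qed.

Let e_ker p : e p = 0 -> exists u v, p = x * u + y * v.
Proof.
by move=> ep; have [u [v pE]] := e_split p; exists u, v; rewrite {1}pE ep add0r.
Qed.

(* [:: p_0; ...; p_d] stands for the form p_0 x^d + p_1 x^(d-1) y + ... + p_d y^d. *)
Fixpoint binary_form (s : seq R) : R :=
  if s is p :: s' then p * x ^+ size s' + y * binary_form s' else 0.

(** Regularity of a power of [x] with [y] makes the leading coefficient a multiple [y * r]. Dividing
    by [y] moves [x * r] into the next coefficient, which does not change its image under [e], and
    leaves a shorter list. *)
Lemma binary_form_eq0 s : binary_form s = 0 -> all (fun p => e p == 0) s.
Proof.
have [n] := ubnP (size s); elim: n s => // n IHn [|p [|q s]] //= sn.
  by rewrite expr0 mulr1 mulr0 addr0 => ->; rewrite rmorph0 eqxx.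
move=> s0.
have [|r pE sE] := @Xn_reg (size s).+1 p (- (q * x ^+ size s + y * binary_form s)).
  by apply: (eq_lincomb (k := 1) s0); ring.
have /(IHn (_ :: _))/= : (size ((q + x * r)%R :: s) < n)%N by [].
rewrite pE rmorphM ey mul0r eqxx rmorphD (rmorphM _ x) ex mul0r addr0; apply.
by apply: (eq_lincomb (k := -1) sE); rewrite exprS; ring.
Qed.

Lemma d5_inj r : d5 x y a b c r = 0 -> r = 0.
Proof. by case=> _ _ _ _ /eqP; rewrite mulf_eq0 (negPf x0) => /eqP. Qed.

(** The last row is a Koszul relation that determines [r]; the rows of the X_i then give the p_i
    after cancelling [y]. *)
Lemma d4_ker z : d4 x y a b c z = 0 -> exists r, d5 x y a b c r = z.
Proof.
case: z => [[[p1 p2] p3] [u v]] [_ _ _ h1 h2 h3 _ _ _ h].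
have [|r uE vE] := @xy_reg u (- v).
  by apply: (eq_lincomb (k := 1) h); ring.
exists (- r); rewrite /d5.
have yI := mulfI y0.
congr ((_, _, _), (_, _)).
- by apply: yI; apply: (eq_lincomb (k := 1) h1); rewrite uE; ring.
- by apply: yI; apply: (eq_lincomb (k := 1) h2); rewrite uE; ring.
- by apply: yI; apply: (eq_lincomb (k := 1) h3); rewrite uE; ring.
- by rewrite uE; ring.
- by rewrite mulrN -vE opprK.
Qed.

Lemma d3_ker z : d3 x y a b c z = 0 -> exists t, d4 x y a b c t = z.
Proof.
case: z => [[[[[s0 s1] s2] [[X1 X2] X3]] [[Y1 Y2] Y3]] t].
case=> _ h0 h1 h2 h3 k1 k2 k3.
(* Modulo (x, y) the row [k1] reads [a * e t = 0]. *)
have [u [v tE]] : exists u v, t = x * u + y * v.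
  apply: e_ker; apply: (mulfI a0); rewrite mulr0 -(rmorph0 e) -k1.
  by rewrite !rmorphD !rmorphM ex ey ea; ring.
(* Substituting [t] turns each of the last three rows into a Koszul relation of [x] and [y]. *)
have [|p1 X1E Y1E] := @xy_reg (X1 + a * u) (- (Y1 + a * v)).
  by apply: (eq_lincomb (k := 1) k1); rewrite tE; ring.
have [|p2 X2E Y2E] := @xy_reg (X2 - b * u) (- (Y2 - b * v)).
  by apply: (eq_lincomb (k := 1) k2); rewrite tE; ring.
have [|p3 X3E Y3E] := @xy_reg (X3 + c * u) (- (Y3 + c * v)).
  by apply: (eq_lincomb (k := 1) k3); rewrite tE; ring.
have X1F : - (y * - p1) - a * u = X1 by apply: (eq_lincomb (k := -1) X1E); ring.
have X2F : - (y * - p2) + b * u = X2 by apply: (eq_lincomb (k := -1) X2E); ring.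
have X3F : - (y * - p3) - c * u = X3 by apply: (eq_lincomb (k := -1) X3E); ring.
have Y1F : x * - p1 - a * v = Y1 by apply: (eq_lincomb (k := 1) Y1E); ring.
have Y2F : x * - p2 + b * v = Y2 by apply: (eq_lincomb (k := 1) Y2E); ring.
have Y3F : x * - p3 - c * v = Y3 by apply: (eq_lincomb (k := 1) Y3E); ring.
exists ((- p1, - p2, - p3), (u, v)).
have xI := mulfI x0; have yI := mulfI y0.
have s0E : b * - p1 + a * - p2 = s0.
  by apply: yI; apply: (eq_lincomb (k := 1) h0); rewrite -X1F -X2F; ring.
have s2E : - (c * - p2) - b * - p3 = s2.
  by apply: xI; apply: (eq_lincomb (k := -1) h3); rewrite -Y2F -Y3F; ring.
have s1E : - (c * - p1) + a * - p3 = s1.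
  apply: yI; apply: (eq_lincomb (k := 1) h1).
  by rewrite -X1F -X3F -Y1F -Y2F -s0E; ring.
by rewrite /d4 X1F X2F X3F Y1F Y2F Y3F s0E s1E s2E tE.
Qed.

(** The monomials are peeled off one at a time: [y] divides the leading coefficient, and cancelling
    it leaves a relation of lower degree. *)
Lemma cubic_syzygy m0 m1 m2 m3 :
    x ^+ 3 * m0 + x ^+ 2 * y * m1 + x * y ^+ 2 * m2 + y ^+ 3 * m3 = 0 ->
  exists s0 s1 s2, [/\ m0 = - (y * s0), m1 = x * s0 - y * s1,
                       m2 = x * s1 - y * s2 & m3 = x * s2].
Proof.
move=> h; have yI := mulfI y0.
have [|s0 m0E h0] := @Xn_reg 3 m0 (- (x ^+ 2 * m1 + x * y * m2 + y ^+ 2 * m3)).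
  by apply: (eq_lincomb (k := 1) h); ring.
have [|s1 m1E h1] := @Xn_reg 2 (m1 + x * s0) (- (x * m2 + y * m3)).
  by apply: (eq_lincomb (k := -1) h0); ring.
have [|s2 m2E m3E] := @xy_reg (m2 + x * s1) (- m3).
  by apply: (eq_lincomb (k := -1) h1); ring.
exists (- s0), (- s1), (- s2); split.
- by rewrite m0E; ring.
- by apply: (eq_lincomb (k := 1) m1E); ring.
- by apply: (eq_lincomb (k := 1) m2E); ring.
- by apply: (eq_lincomb (k := -1) m3E); ring.
Qed.

Lemma d2_ker z : d2 x y a b c z = 0 -> exists t, d3 x y a b c t = z.
Proof.
case: z => [[e0 [[[m0 m1] m2] m3]] [[g1 g2] g3]] [_ hE hF].
(* The third row of [d2] is read as a quadratic form in [x], [y], so that the m_i disappear modulo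
   (x, y). *)
have /binary_form_eq0 : binary_form [:: b * g1 + a * g2 + x * m0 + y * m1;
    - (c * g1) + a * g3 + y * m2; - (c * g2) - b * g3 + y * m3] = 0.
  by apply: (eq_lincomb (k := -1) hF); rewrite /=; ring.
rewrite /= => /and4P[/eqP hA /eqP hB _ _].
have {}hA : b * e g1 + a * e g2 = 0.
  by rewrite -[RHS]hA !rmorphD !rmorphM ex ey ea eb; ring.
have {}hB : - (c * e g1) + a * e g3 = 0.
  by rewrite -[RHS]hB !rmorphD rmorphN !rmorphM ey ea ec; ring.
(* Modulo (x, y) the g_i are a multiple of [(a, -b, c)]; the factor [- r] becomes the coordinate t
   of the preimage. *)
have [|r eg2 eg1] := @ab_reg (e g2) (- e g1).
  by apply: (eq_lincomb (k := 1) hA); ring.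
have {}eg1 : e g1 = a * - r by apply: (eq_lincomb (k := -1) eg1); ring.
have eg3 : e g3 = c * - r.
  by apply: (mulfI a0); apply: (eq_lincomb (k := 1) hB); rewrite eg1; ring.
have [X1 [Y1 g1E]] := e_split g1; rewrite eg1 in g1E.
have [X2 [Y2 g2E]] := e_split g2; rewrite eg2 in g2E.
have [X3 [Y3 g3E]] := e_split g3; rewrite eg3 in g3E.
(* Once the contributions of the X_i, Y_i and t are subtracted, only a syzygy of the cubic monomials
   is left. *)
have [|s0 [s1 [s2 [m0E m1E m2E m3E]]]] := @cubic_syzygy (m0 + b * X1 + a * X2)
    (m1 - c * X1 + b * Y1 + a * Y2 + a * X3)
    (m2 - c * Y1 - c * X2 - b * X3 + a * Y3) (m3 - c * Y2 - b * Y3).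
  by apply: (eq_lincomb (k := -1) hF); rewrite g1E g2E g3E; ring.
exists ((s0, s1, s2), (X1, X2, X3), (Y1, Y2, Y3), - r); rewrite /d3.
have m0F : - (y * s0) - b * X1 - a * X2 = m0.
  by apply: (eq_lincomb (k := -1) m0E); ring.
have m1F : x * s0 - y * s1 + c * X1 - b * Y1 - a * Y2 - a * X3 = m1.
  by apply: (eq_lincomb (k := -1) m1E); ring.
have m2F : x * s1 - y * s2 + c * Y1 + c * X2 + b * X3 - a * Y3 = m2.
  by apply: (eq_lincomb (k := -1) m2E); ring.
have m3F : x * s2 + c * Y2 + b * Y3 = m3.
  by apply: (eq_lincomb (k := -1) m3E); ring.
have g1F : x * X1 + y * Y1 + a * - r = g1 by rewrite g1E; ring.
have g2F : x * X2 + y * Y2 - b * - r = g2 by rewrite g2E; ring.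
have g3F : x * X3 + y * Y3 + c * - r = g3 by rewrite g3E; ring.
rewrite m0F m1F m2F m3F g1F g2F g3F.
(* The second row of [d2] determines [x ^+ 3 * e0] from the other coordinates. *)
suff -> : e0 = - (c * s0 + b * s1 + a * s2) by [].
apply: (mulfI (expf_neq0 3 x0)); apply: (eq_lincomb (k := 1) hE).
by rewrite -m1F -m2F -m3F -g1F -g2F -g3F /cubic_form; ring.
Qed.

(** The relation is read as a binary form of degree 2, 3 and 4 in turn. The first two readings put
    [w] in (x, y) and then in its square; the third identifies the quadratic part of [w] as a
    combination of the g_i. *)
Lemma d1_ker z : d1 x y a b c z = 0 -> exists t, d2 x y a b c t = z.
Proof.
case: z => [[u v] w] h.
have [w1 [w2 wE]] : exists w1 w2, w = x * w1 + y * w2.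
  apply: e_ker.
  have /binary_form_eq0 : binary_form [:: x * u + a * w; b * w; c * w + y * v] = 0.
    by apply: (eq_lincomb (k := 1) h); rewrite /= /cubic_form; ring.
  rewrite /= rmorphD !rmorphM ex ea mul0r add0r mulf_eq0 (negPf a0).
  by case/andP => /eqP.
(* The two middle coefficients form a linear system in [e w1], [e w2] with determinant
   [b ^+ 2 - a * c]. *)
have [eu ev ew1 ew2] : [/\ e u = 0, e v = 0, e w1 = 0 & e w2 = 0].
  have /binary_form_eq0 : binary_form
      [:: u + a * w1; b * w1 + a * w2; c * w1 + b * w2; v + c * w2] = 0.
    by apply: (eq_lincomb (k := 1) h); rewrite /= wE /cubic_form; ring.
  rewrite /= !rmorphD !rmorphM ea eb ec.
  case/and5P => /eqP hu /eqP h1 /eqP h2 /eqP hv _.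
  have ew1 : e w1 = 0.
    apply: (mulfI disc0); rewrite mulr0 -[RHS](mulr0 b) -[in RHS]h1.
    by apply: (eq_lincomb (k := - a) h2); ring.
  have ew2 : e w2 = 0.
    by apply: (mulfI a0); apply: (eq_lincomb (k := 1) h1); rewrite ew1; ring.
  by move: hu hv; rewrite ew1 ew2 !mulr0 !addr0.
have [u1 [u2 uE]] := e_ker eu; have [v1 [v2 vE]] := e_ker ev.
have [p [q1 w1E]] := e_ker ew1; have [q2 [r w2E]] := e_ker ew2.
have [q {w1E w2E}wE] : exists q, w = x ^+ 2 * p + x * y * q + y ^+ 2 * r.
  by exists (q1 + q2); rewrite wE w1E w2E; ring.
(* The middle coefficient of the quartic form involves neither [u] nor [v] and is a syzygy of [a],
   [b], [c]. *)
have [al [be [ga [er eq ep]]]] : exists u v w, [/\ e r = - (c * v) - b * w,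
    e q = a * w - c * u & e p = b * u + a * v].
  apply: abc_reg.
  have /binary_form_eq0 : binary_form [:: u1 + a * p; u2 + b * p + a * q;
      c * p + b * q + a * r; c * q + b * r + v1; c * r + v2] = 0.
    by apply: (eq_lincomb (k := 1) h); rewrite /= uE vE wE /cubic_form; ring.
  rewrite /= => /and5P[_ _ /eqP hc _ _].
  by rewrite -[RHS]hc !rmorphD !rmorphM ea eb ec; ring.
have [p1 [p2 pE]] := e_split p; rewrite ep in pE.
have [s1 [s2 qE]] := e_split q; rewrite eq in qE.
have [r1 [r2 rE]] := e_split r; rewrite er in rE.
pose lift e0 := d2 x y a b c
  (e0, (- p1, - (p2 + s1), - (s2 + r1), - r2), (- al, - be, - ga)).
have wF e0 : (lift e0).2 = w by rewrite wE pE qE rE /lift /=; ring.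
(* What [lift 0] misses is a syzygy of [x ^+ 3] and [y ^+ 3], which the coordinate [e0] absorbs. *)
have h0 : x ^+ 3 * (u - (lift 0).1.1) = y ^+ 3 * - (v - (lift 0).1.2).
  have h1 : d1 x y a b c (u, v, w) = d1 x y a b c (lift 0) by rewrite h d1_d2.
  apply: (eq_lincomb (k := 1) h1).
  by move: (wF 0); case: (lift 0) => [[U V] W] /= ->; ring.
have [e0 uF vF] := regular_pair_sym (regular_pairX (n := 3) (expf_neq0 3 x0)
  (regular_pair_sym (@Xn_reg 3))) h0.
exists (- e0, (- p1, - (p2 + s1), - (s2 + r1), - r2), (- al, - be, - ga)).
rewrite -/(lift (- e0)); apply: pair_ext; last exact: wF.
apply: pair_ext.
  by apply: (eq_lincomb (k := -1) uF); rewrite /=; ring.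
by apply: (eq_lincomb (k := 1) vF); rewrite /=; ring.
Qed.

End Exactness.

(** * The resolution of R / (x^3, y^3, f) *)

Section QuotientProjection.
Local Open Scope quotient_scope.
Variables (R : pzRingType) (V : lmodType R) (N : submodClosed V).

Definition quotmod_pi (v : V) : quotmod N := \pi_({quot submod_pred N}) v.

Fact quotmod_pi_linear : linear quotmod_pi.
Proof.
move=> k u v; rewrite /quotmod_pi raddfD /=; congr (_ + _).
by rewrite -quotmod_scale_pi.
Qed.

HB.instance Definition _ :=
  GRing.isLinear.Build R V (quotmod N) _ quotmod_pi quotmod_pi_linear.

Lemma quotmod_pi_surj : surj quotmod_pi.
Proof. by move=> z; exists (repr z); rewrite /quotmod_pi reprK. Qed.

Lemma quotmod_pi_eq0 v : quotmod_pi v = 0 <-> v \in N.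
Proof.
have := idealrBE (submod_pred N) v 0; rewrite subr0 => piE.
by rewrite -[v \in N]/(v \in submod_pred N) piE -(rwP eqP) raddf0.
Qed.

End QuotientProjection.

Section Resolution.
Variables (R : idomainType) (x y a b c : R) (e : {rmorphism R -> R}).
Hypotheses (ex : e x = 0) (ey : e y = 0).
Hypotheses (ea : e a = a) (eb : e b = b) (ec : e c = c).
Hypothesis e_split : forall p, exists u v, p = e p + x * u + y * v.
Hypotheses (x0 : x != 0) (y0 : y != 0) (a0 : a != 0).
Hypothesis disc0 : b ^+ 2 - a * c != 0.
Hypotheses (xy_reg : regular_pair x y) (ab_reg : regular_pair a b).
Hypothesis abc_reg : forall p q r, a * p + b * q + c * r = 0 ->
  exists u v w, [/\ p = - (c * v) - b * w, q = a * w - c * u & r = b * u + a * v].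

Definition three_cubics (i : 'I_3) : R :=
  [:: x ^+ 3; y ^+ 3; cubic_form x y a b c]`_i.

Let M := quotmod (ideal_gen three_cubics).

Lemma ideal_gen_cubics (p : R^o) :
  p \in ideal_gen three_cubics <-> exists z, d1 x y a b c z = p.
Proof.
split=> [/asboolP[t ->]|[[[u v] w] <-]].
  exists (t ord0, t (lift ord0 ord0), t (lift ord0 (lift ord0 ord0))).
  by rewrite !big_ord_recl big_ord0 addr0 /three_cubics /= addrA.
apply/asboolP; exists (fun i => [:: u; v; w]`_i).
by rewrite !big_ord_recl big_ord0 addr0 /three_cubics /= addrA.
Qed.

Definition cubics_obj (i : nat) : lmodType R :=
  match i with
  | 0 => R^o | 1 => F1 R | 2 => F2 R | 3 => F3 R | 4 => F4 R | 5 => R^o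
  | _ => 'rV[R]_0
  end.

Definition cubics_diff (i : nat) : {linear cubics_obj i.+1 -> cubics_obj i} :=
  match i with
  | 0 => d1 x y a b c | 1 => d2 x y a b c | 2 => d3 x y a b c
  | 3 => d4 x y a b c | 4 => d5 x y a b c | 5 => \0 | _ => \0
  end.

Lemma cubics_obj_proj i : projective (cubics_obj i).
Proof.
have P0 := @projective_regular R.
have PF1 : projective (F1 R) by do 2!apply: projective_prod => //.
case: i => [|[|[|[|[|[|i]]]]]] //=; do ?apply: projective_prod => //.
by apply: projective_zero => z; apply/rowP; case.
Qed.

Lemma cubics_exact0 :
  exact_at (cubics_diff 0) (@quotmod_pi _ _ (ideal_gen three_cubics)).
Proof. by move=> p; rewrite quotmod_pi_eq0 ideal_gen_cubics. Qed.

Lemma cubics_exactS i : exact_at (cubics_diff i.+1) (cubics_diff i).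
Proof.
have im_ker (A B C : Type) (f : A -> B) (g : B -> C) o :
    (forall p, g (f p) = o) -> (forall z, g z = o -> exists t, f t = z) ->
  forall z, g z = o <-> exists t, f t = z.
  by move=> gf ker z; split=> [/ker|[t <-]].
case: i => [|[|[|[|[|[|i]]]]]]; apply: im_ker.
- exact: d1_d2.
- exact: (d1_ker ex ey ea eb ec).
- exact: d2_d3.
- exact: (d2_ker ex ey ea eb ec).
- exact: d3_d4.
- exact: (d3_ker ex ey ea).
- exact: d4_d5.
- exact: d4_ker.
- by move=> p; rewrite linear0.
- by move=> z /(d5_inj x0) ->; exists 0.
- by [].
- by move=> z _; exists 0; apply/rowP; case.
- by [].
- by move=> z _; exists 0; apply/rowP; case.
Qed.

Definition cubics_resolution : proj_resolution M :=
  ProjResolution cubics_obj_proj (@quotmod_pi_surj _ _ _) cubics_exact0 cubics_exactS.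

Lemma cubics_pd_le5 : pd_le M 5.
Proof.
exists cubics_resolution; case=> [|[|[|[|[|[|i]]]]]] // _ z.
by apply/rowP; case.
Qed.

Lemma cubics_pd_ge5 (K : nzRingType) (ev : {rmorphism R -> K}) d :
    ev x = 0 -> ev y = 0 -> ev a = 0 -> ev b = 0 -> ev c = 0 ->
  pd_le M d -> (5 <= d)%N.
Proof.
move=> evx evy eva evb evc Md; rewrite leqNgt; apply/negP => dlt5.
(* With index 4 the split map is [d5], from degree 5 to degree 4; the side condition is that degree
   6 vanishes. *)
have [z|h hP] := pd_le_split (F := cubics_resolution)
  (pd_le_leq (dlt5 : (d <= 4)%N) Md).
  by apply/rowP; case.
pose g : {linear F4 R -> R^o} := h.
(* On the standard basis, linearity writes [g (d5 1)] as a combination of the five elements killed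
   by [ev]. *)
have d5E : d5 x y a b c 1 = a *: (((1, 0, 0), (0, 0)) : F4 R)
    - b *: (((0, 1, 0), (0, 0)) : F4 R) + c *: (((0, 0, 1), (0, 0)) : F4 R)
    - y *: (((0, 0, 0), (1, 0)) : F4 R) + x *: (((0, 0, 0), (0, 1)) : F4 R).
  apply: pair_ext; [triple_ext|apply: pair_ext];
    rewrite /=; do ?rewrite /GRing.scale /=; ring.
have /eqP[] := oner_neq0 K.
rewrite -(rmorph1 ev) -(hP 1 : g (d5 x y a b c 1) = 1) d5E.
rewrite !(linearD, linearB, linearZ) /= !(rmorphD, rmorphB, rmorphM) /=.
by rewrite evx evy eva evb evc !mul0r !(addr0, subr0).
Qed.

End Resolution.

(** * Polynomial rings *)

Section VariableElimination.
Variables (k : fieldType) (n : nat).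
Implicit Types (i j l : 'I_n) (p q r : {mpoly k[n]}).

(** The substitution X_i = 0 is an endomorphism, so that reduction modulo X_i stays inside the
    ring. *)
Definition kill i : {mpoly k[n]} -> {mpoly k[n]} :=
  comp_mpoly [tuple (if j == i then 0 else 'X_j) | j < n].
HB.instance Definition _ i := GRing.RMorphism.on (kill i).

Lemma killX i j : kill i 'X_j = if j == i then 0 else 'X_j.
Proof. by rewrite /kill comp_mpolyXU -tnth_nth tnth_mktuple. Qed.

(** The property passes to linear combinations and products, hence need only be checked on
    variables. *)
Lemma kill_split i p : exists q, p = kill i p + 'X_i * q.
Proof.
elim/mpolyind: p => [|c m p _ _ [q pE]].
  by exists 0; rewrite rmorph0 mulr0 addr0.
suff [s mE] : exists s, 'X_[m] = kill i 'X_[m] + 'X_i * s.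
  exists (c%:MP * s + q); rewrite {1}pE {1}mE -!mul_mpolyC rmorphD rmorphM /=.
  rewrite [kill i c%:MP]comp_mpolyC; ring.
rewrite mpolyXE_id; apply: (big_ind (fun p => exists s, p = kill i p + 'X_i * s)).
- by exists 0; rewrite rmorph1 mulr0 addr0.
- move=> p1 p2 [s1 p1E] [s2 p2E]; exists (s1 * kill i p2 + p1 * s2).
  by rewrite rmorphM /= {1}p2E mulrDr {1}p1E; ring.
move=> j _; elim: (m j) => [|t [s tE]].
  by exists 0; rewrite expr0 rmorph1 mulr0 addr0.
have [u uE] : exists u, 'X_j = kill i 'X_j + 'X_i * u :> {mpoly k[n]}.
  rewrite killX; case: eqP => [->|_]; first by exists 1; rewrite mulr1 add0r.
  by exists 0; rewrite mulr0 addr0.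
exists (u * kill i ('X_j ^+ t) + 'X_j * s).
by rewrite exprS rmorphM /= {1}tE mulrDr {1}uE; ring.
Qed.

Lemma kill_ker i p : kill i p = 0 -> exists q, p = 'X_i * q.
Proof.
by move=> p0; have [q pE] := kill_split i p; exists q; rewrite {1}pE p0 add0r.
Qed.

Lemma mpolyX_neq0 i : 'X_i != 0 :> {mpoly k[n]}.
Proof.
apply/eqP => /(congr1 (mcoeff U_(i)%MM)); rewrite mcoeffX eqxx mcoeff0.
exact/eqP/oner_neq0.
Qed.

(** Setting X_j = 0 in the relation shows that X_j divides [p]. *)
Lemma regular_pair_mpolyX i j : i != j -> regular_pair ('X_i : {mpoly k[n]}) 'X_j.
Proof.
move=> neq_ij p q pq.
have [r pE] : exists r, p = 'X_j * r.
  apply: kill_ker; apply: (mulfI (mpolyX_neq0 i)); rewrite mulr0.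
  have := congr1 (kill j) pq.
  by rewrite !rmorphM /= !killX eqxx (negPf neq_ij) mul0r.
exists r => //; apply: (mulfI (mpolyX_neq0 j)).
by rewrite -pq pE mulrCA.
Qed.

(** Setting X_i = 0 and then X_j = 0 puts [r] in (X_i, X_j); substituting it leaves a relation
    between X_i and X_j only. *)
Lemma mpolyX_koszul3 i j l p q r : uniq [:: i; j; l] ->
    'X_i * p + 'X_j * q + 'X_l * r = 0 ->
  exists u v w, [/\ p = - ('X_l * v) - 'X_j * w, q = 'X_i * w - 'X_l * u
                  & r = 'X_j * u + 'X_i * v].
Proof.
rewrite /= !inE !negb_or => /and3P[/andP[ij il] jl _] h.
have [v hv] := kill_split i r; have [u hu] : exists u, kill i r = 'X_j * u.
  have := congr1 (kill i) h; rewrite !rmorphD !rmorphM rmorph0 /= !killX eqxx.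
  rewrite eq_sym (negPf ij) eq_sym (negPf il) mul0r add0r => h1.
  apply: kill_ker; apply: (mulfI (mpolyX_neq0 l)); rewrite mulr0.
  have := congr1 (kill j) h1; rewrite !rmorphD !rmorphM rmorph0 /= !killX eqxx.
  by rewrite eq_sym (negPf jl) mul0r add0r.
rewrite hu in hv.
have [|w wp wq] := @regular_pair_mpolyX _ _ ij (p + 'X_l * v) (- (q + 'X_l * u)).
  by apply: (eq_lincomb (k := 1) h); rewrite hv; ring.
exists u, v, (- w); split=> //.
  by apply: (eq_lincomb (k := 1) wp); ring.
by apply: (eq_lincomb (k := -1) wq); ring.
Qed.

End VariableElimination.

Theorem mainTheorem2 :
  exists (k : fieldType) (n : nat) (f : 'I_3 -> {mpoly k[n]}),
    (forall i, f i \is 3.-homog) /\ pd_eq (quotmod (ideal_gen f)) 5.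
Proof.
pose R := {mpoly rat[5]}; pose X i : R := 'X_(inord i).
have neq_ord i j : (i < 5)%N -> (j < 5)%N -> (inord i == inord j :> 'I_5) = (i == j).
  by move=> i5 j5; rewrite -val_eqE /= !inordK.
have homX i : X i \is 1.-homog by rewrite dhomogX /= mdeg1.
exists rat, 5, (three_cubics (X 0) (X 1) (X 2) (X 3) (X 4)); split.
  have X3 i : X i ^+ 3 \is 3.-homog by apply: (dhomogMn 3 (homX i)).
  have X2 i j : X i ^+ 2 * X j \is 3.-homog.
    by apply: (@dhomogM _ _ _ 2 _ 1) => //; exact: (dhomogMn 2 (homX i)).
  have X111 i j l : X i * X j * X l \is 3.-homog.
    by apply: (@dhomogM _ _ _ 2 _ 1) => //; exact: (@dhomogM _ _ _ 1 _ 1).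
  by case=> [[|[|[|//]]]] ? //=; rewrite /three_cubics /= /cubic_form ?dhomogD.
(* The retraction sets [X 0] and [X 1], the variables x and y, to zero. *)
pose e : {rmorphism R -> R} := kill (inord 1) \o kill (inord 0).
have eX i : (i < 5)%N -> e (X i) = if (i < 2)%N then 0 else X i.
  move=> i5; rewrite /e /= /X killX neq_ord //; case: i i5 => [|[|i]] i5.
  - by rewrite rmorph0.
  - by rewrite killX eqxx.
  - by rewrite killX neq_ord.
have e_split p : exists u v, p = e p + X 0 * u + X 1 * v.
  have [u pE] := kill_split (inord 0) p.
  have [v qE] := kill_split (inord 1) (kill (inord 0) p).
  by exists u, v; rewrite {1}pE {1}qE addrAC.
have X0 i : X i != 0 by exact: mpolyX_neq0.
have disc0 : X 3 ^+ 2 - X 2 * X 4 != 0.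
  (* At the point b = 1 with all other variables zero, the determinant is 1. *)
  apply/eqP => /(congr1 (meval (fun i => (i == inord 3)%:R))).
  rewrite mevalB !rmorphXn mevalM /= !mevalXU !neq_ord //= meval0 mul0r subr0 expr1n.
  exact/eqP/oner_neq0.
have reg i j : (i < 5)%N -> (j < 5)%N -> i != j -> regular_pair (X i) (X j).
  by move=> i5 j5 ij; apply: regular_pair_mpolyX; rewrite neq_ord.
have abc_reg := @mpolyX_koszul3 rat 5 (inord 2) (inord 3) (inord 4).
rewrite /= !inE !neq_ord //= in abc_reg; have {}abc_reg p q r := abc_reg p q r isT.
split.
  by apply: (@cubics_pd_le5 R _ _ _ _ _ e) => //; rewrite ?eX //; exact: reg.
(* [ev] is evaluation at the origin. *)
move=> d; apply: (@cubics_pd_ge5 R _ _ _ _ _ e _ _ _ _ _ _ _ _ _ _ _ _ _ _ (meval (fun=> 0))) => //;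
  by [rewrite eX | rewrite /= mevalXU | exact: reg].
Qed.
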